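(* Let $\mathcal{E}$ be an extriangulated category and $C\subseteq as(\mathcal{E})$ a subset such that the space $Esp_C(\mathcal{E})$ is Noetherian. Then $Esp_C(\mathcal{E})$ is a spectral space if and only if it is sober; equivalently, if and only if $\mathcal{P}(Z):=\{E\in\mathcal{E}: U_C(E)\cap Z\neq\emptyset\}$ belongs to $C$ for every nonempty irreducible closed subset $Z\subseteq Esp_C(\mathcal{E})$.
   Context: $\mathcal{E}$ is an extriangulated category (Nakaoka–Palu). $as(\mathcal{E})$ denotes the collection of non-empty full subcategories of $\mathcal{E}$ closed under finite direct sums and direct summands (hence containing $0$). For $C\subseteq as(\mathcal{E})$ and a class $\mathcal{X}$ of objects put $Z_C(\mathcal{X})=\{\mathcal{P}\in C:\mathcal{P}\cap\mathcal{X}=\emptyset\}$ and $U_C(\mathcal{X})=C\setminus Z_C(\mathcal{X})$. The sets $Z_C(\mathcal{X})$ are the closed sets of a topology on $C$; the resulting space is $Esp_C(\mathcal{E})$. For an object $E$, $U_C(E):=U_C(\{E\})=\{\mathcal{P}\in C: E\in\mathcal{P}\}$. A topological space is spectral if it is homeomorphic to the prime spectrum of a commutative ring. A space is sober if every nonempty irreducible closed subset has a unique generic point. *)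

(* Defs.v *)
From HB Require Import structures.
From mathcomp Require Import all_boot all_order all_algebra.
From mathcomp Require Import all_classical topology.

Set Implicit Arguments.
Unset Strict Implicit.
Unset Printing Implicit Defensive.

Import GRing.Theory.

Local Open Scope classical_set_scope.
Local Open Scope ring_scope.

Reserved Notation "g \oc f" (at level 40, left associativity).

Record preadditive_category := PreadditiveCategory {
  obj :> Type;
  hom : obj -> obj -> zmodType;
  idm : forall A, hom A A;
  comp : forall A B D, hom B D -> hom A B -> hom A D
    where "g \oc f" := (comp g f);
  comp1m : forall A B (f : hom A B), idm B \oc f = f;
  compm1 : forall A B (f : hom A B), f \oc idm A = f;
  compmA : forall A B D F (h : hom D F) (g : hom B D) (f : hom A B),
    h \oc (g \oc f) = (h \oc g) \oc f;
  compmDl : forall A B D (g g' : hom B D) (f : hom A B),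
    (g + g') \oc f = g \oc f + g' \oc f;
  compmDr : forall A B D (g : hom B D) (f f' : hom A B),
    g \oc (f + f') = g \oc f + g \oc f'
}.

Arguments idm {p} A.
Arguments comp {p A B D}.
Notation "g \oc f" := (comp g f).

Section PreadditiveCategory.
Context {E : preadditive_category}.

Definition is_iso (A B : E) (f : hom A B) : Prop :=
  exists g : hom B A, g \oc f = idm A /\ f \oc g = idm B.

Definition is_zero_object (N : E) : Prop :=
  forall A : E, (forall f : hom N A, f = 0) /\ (forall f : hom A N, f = 0).

(* [biproduct A B S] : the ways in which S is a direct sum of A and B. *)
Record biproduct (A B S : E) := Biproduct {
  in1 : hom A S;
  in2 : hom B S;
  pr1 : hom S A;
  pr2 : hom S B;
  pr1_in1 : pr1 \oc in1 = idm A;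
  pr2_in2 : pr2 \oc in2 = idm B;
  pr1_in2 : pr1 \oc in2 = 0;
  pr2_in1 : pr2 \oc in1 = 0;
  in_pr : in1 \oc pr1 + in2 \oc pr2 = idm S
}.

Definition hom_sum (A A' SA B B' SB : E)
    (bA : biproduct A A' SA) (bB : biproduct B B' SB)
    (f : hom A B) (f' : hom A' B') : hom SA SB :=
  in1 bB \oc f \oc pr1 bA + in2 bB \oc f' \oc pr2 bA.

Definition direct_summand (A S : E) : Prop :=
  exists B : E, inhabited (biproduct A B S).

(* Equivalence of the sequences A -x-> B -y-> D and A -x'-> B' -y'-> D. *)
Definition seq_equiv (A B B' D : E) (x : hom A B) (y : hom B D)
    (x' : hom A B') (y' : hom B' D) : Prop :=
  exists b : hom B B', [/\ is_iso b, b \oc x = x' & y' \oc b = y].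

End PreadditiveCategory.

Definition is_additive (E : preadditive_category) : Prop :=
  (exists N : E, is_zero_object N) /\
  (forall A B : E, exists S : E, inhabited (biproduct A B S)).

(* [Ext D A] is contravariant in D and covariant in A; [push a] is a_* and
   [pull c] is c^*. *)
Record additive_bifunctor (E : preadditive_category) := AdditiveBifunctor {
  Ext :> E -> E -> zmodType;
  push : forall (A A' : E), hom A A' -> forall D, Ext D A -> Ext D A';
  pull : forall (D' D : E), hom D' D -> forall A, Ext D A -> Ext D' A;
  push_id : forall A D (d : Ext D A), push (idm A) d = d;
  pull_id : forall A D (d : Ext D A), pull (idm D) d = d;
  push_comp : forall A A' A'' (a' : hom A' A'') (a : hom A A') D
    (d : Ext D A), push (a' \oc a) d = push a' (push a d);
  pull_comp : forall D D' D'' (c : hom D' D) (c' : hom D'' D') A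
    (d : Ext D A), pull (c \oc c') d = pull c' (pull c d);
  push_pull : forall A A' (a : hom A A') D D' (c : hom D' D) (d : Ext D A),
    push a (pull c d) = pull c (push a d);
  push_ext_add : forall A A' (a : hom A A') D (d d' : Ext D A),
    push a (d + d') = push a d + push a d';
  pull_ext_add : forall D' D (c : hom D' D) A (d d' : Ext D A),
    pull c (d + d') = pull c d + pull c d';
  push_hom_add : forall A A' (a a' : hom A A') D (d : Ext D A),
    push (a + a') d = push a d + push a' d;
  pull_hom_add : forall D' D (c c' : hom D' D) A (d : Ext D A),
    pull (c + c') d = pull c d + pull c' d
}.

Arguments push {E _ A A'} a {D} d : rename.
Arguments pull {E _ D' D} c {A} d : rename.

Section Extriangulation.
Context {E : preadditive_category} (X : additive_bifunctor E).

(* (a, c) is a morphism of extensions from d to d'. *)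
Definition ext_morphism (A D A' D' : E) (d : X D A) (d' : X D' A')
    (a : hom A A') (c : hom D D') : Prop :=
  push a d = pull c d'.

Definition ext_sum (A A' SA D D' SD : E)
    (bA : biproduct A A' SA) (bD : biproduct D D' SD)
    (d : X D A) (d' : X D' A') : X SD SA :=
  push (in1 bA) (pull (pr1 bD) d) + push (in2 bA) (pull (pr2 bD) d').

(* A correspondence s associating to each extension an equivalence class of
   sequences is encoded by the relation
   [s A B D x y d] : s(d) = [A -x-> B -y-> D]. *)
Definition correspondence :=
  forall A B D : E, hom A B -> hom B D -> X D A -> Prop.

Variable s : correspondence.
Arguments s {A B D}.

Definition valued_in_classes : Prop :=
  forall (A D : E) (d : X D A),
    exists (B : E) (x : hom A B) (y : hom B D),
      forall (B' : E) (x' : hom A B') (y' : hom B' D),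
        s x' y' d <-> seq_equiv x y x' y'.

Definition is_realization : Prop :=
  valued_in_classes /\
  forall (A B D A' B' D' : E) (d : X D A) (d' : X D' A')
    (x : hom A B) (y : hom B D) (x' : hom A' B') (y' : hom B' D')
    (a : hom A A') (c : hom D D'),
    s x y d -> s x' y' d' -> ext_morphism d d' a c ->
    exists b : hom B B', b \oc x = x' \oc a /\ y' \oc b = c \oc y.

Definition is_additive_realization : Prop :=
  [/\ is_realization,
      (forall (A D S : E) (b : biproduct A D S), s (in1 b) (pr2 b) 0) &
      (forall (A B D A' B' D' SA SB SD : E)
         (bA : biproduct A A' SA) (bB : biproduct B B' SB)
         (bD : biproduct D D' SD) (d : X D A) (d' : X D' A')
         (x : hom A B) (y : hom B D) (x' : hom A' B') (y' : hom B' D'),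
         s x y d -> s x' y' d' ->
         s (hom_sum bA bB x x') (hom_sum bB bD y y') (ext_sum bA bD d d'))].

Definition ET3 : Prop :=
  forall (A B D A' B' D' : E) (d : X D A) (d' : X D' A')
    (x : hom A B) (y : hom B D) (x' : hom A' B') (y' : hom B' D')
    (a : hom A A') (b : hom B B'),
    s x y d -> s x' y' d' -> b \oc x = x' \oc a ->
    exists c : hom D D', ext_morphism d d' a c /\ c \oc y = y' \oc b.

Definition ET3op : Prop :=
  forall (A B D A' B' D' : E) (d : X D A) (d' : X D' A')
    (x : hom A B) (y : hom B D) (x' : hom A' B') (y' : hom B' D')
    (b : hom B B') (c : hom D D'),
    s x y d -> s x' y' d' -> y' \oc b = c \oc y ->
    exists a : hom A A', ext_morphism d d' a c /\ b \oc x = x' \oc a.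

(*   A --f--> B --f'--> D
     |        |         |
     =        g         m
     v        v         v
     A --h--> G --h'--> K
              |         |
              g'        e
              v         v
              F ---=--- F       *)
Definition ET4 : Prop :=
  forall (A B D G F : E) (d : X D A) (d' : X F B)
    (f : hom A B) (f' : hom B D) (g : hom B G) (g' : hom G F),
    s f f' d -> s g g' d' ->
    exists (K : E) (h : hom A G) (h' : hom G K) (m : hom D K) (e : hom K F)
      (d'' : X K A),
      [/\ [/\ h = g \oc f, h' \oc g = m \oc f' & e \oc h' = g'],
          s h h' d'',
          s m e (push f' d'),
          pull m d'' = d &
          push f d'' = pull e d'].

(*   D --m--> K --e--> F
     |        |        |
     =        h'       g'
     v        v        v
     D --f'-> A --f--> B
              |        |
              h        g
              v        v
              G ---=-- G       *)
Definition ET4op : Prop :=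
  forall (D A B F G : E) (d : X B D) (d' : X G F)
    (f' : hom D A) (f : hom A B) (g' : hom F B) (g : hom B G),
    s f' f d -> s g' g d' ->
    exists (K : E) (m : hom D K) (e : hom K F) (h' : hom K A) (h : hom A G)
      (d'' : X G K),
      [/\ [/\ h' \oc m = f', f \oc h' = g' \oc e & h = g \oc f],
          s h' h d'',
          s m e (pull g' d),
          push e d'' = d' &
          push m d = pull g d''].

End Extriangulation.

Record extriangulated_category := ExtriangulatedCategory {
  ecat :> preadditive_category;
  ecat_additive : is_additive ecat;
  ecat_ext : additive_bifunctor ecat;
  ecat_real : correspondence ecat_ext;
  ecat_ET2 : is_additive_realization ecat_real;
  ecat_ET3 : ET3 ecat_real;
  ecat_ET3op : ET3op ecat_real;
  ecat_ET4 : ET4 ecat_real;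
  ecat_ET4op : ET4op ecat_real
}.

(* A full subcategory is given by its class of objects. Closure under direct
   summands includes closure under isomorphism, and together with
   non-emptiness it forces the zero objects (the empty sum) to belong to P. *)
Definition as_subcat (E : extriangulated_category) : set (set E) :=
  [set P | [/\ P !=set0,
    (forall A B S : E, inhabited (biproduct A B S) -> P A -> P B -> P S) &
    (forall A S : E, direct_summand A S -> P S -> P A)]].
Arguments as_subcat E _ : clear implicits.

(* The points are the elements of C; the inclusion C <= as(E) is a parameter
   of the type because it is what makes the sets Z_C(X) the closed sets of a
   topology. *)
Record Esp (E : extriangulated_category) (C : set (set E))
    (subC : C `<=` as_subcat E) : Type := EspPoint {
  esp_val :> set E;
  esp_valP : C esp_val
}.

Section EspTopology.
Context {E : extriangulated_category} {C : set (set E)}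
  (subC : C `<=` as_subcat E).

HB.instance Definition _ := gen_eqMixin (Esp subC).
HB.instance Definition _ := gen_choiceMixin (Esp subC).

Definition Z_C (X : set E) : set (Esp subC) :=
  [set P : Esp subC | (P : set E) `&` X = set0].

Definition U_C (X : set E) : set (Esp subC) := ~` Z_C X.

Lemma U_CP (X : set E) (P : Esp subC) :
  U_C X P <-> ((P : set E) `&` X) !=set0.
Proof.
split=> [/eqP/set0P //|PX PX0].
by have [A] := PX; rewrite PX0.
Qed.

Let esp_open : set_system (Esp subC) := [set U | exists X, U = U_C X].

Let esp_openT : esp_open setT.
Proof.
exists setT; apply/esym/seteqP; split=> // P _; apply/U_CP; rewrite setIT.
by have [] := subC (esp_valP P).
Qed.

Let esp_openI : setI_closed esp_open.
Proof.
move=> _ _ [X ->] [Y ->].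
exists [set S | exists A B, [/\ X A, Y B & inhabited (biproduct A B S)]].
apply/seteqP; split=> P.
  move=> [/U_CP[A [PA XA]] /U_CP[B [PB YB]]]; apply/U_CP.
  have [S bS] := (ecat_additive E).2 A B.
  exists S; split; last by exists A, B.
  by have [_ + _] := subC (esp_valP P); apply; eassumption.
move=> /U_CP[S [PS [A [B [XA YB bS]]]]].
have [_ _ sumP] := subC (esp_valP P).
split; apply/U_CP.
  by exists A; split=> //; apply: sumP PS; exists B.
exists B; split=> //; apply: sumP PS; exists A; case: bS => b.
constructor; apply: (@Biproduct _ _ _ _ (in2 b) (in1 b) (pr2 b) (pr1 b)).
- exact: pr2_in2.
- exact: pr1_in1.
- exact: pr2_in1.
- exact: pr1_in2.
- by rewrite addrC in_pr.
Qed.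

Let esp_open_bigU (I : Type) (f : I -> set (Esp subC)) :
  (forall i, esp_open (f i)) -> esp_open (\bigcup_i f i).
Proof.
move=> /choice[X fX]; exists (\bigcup_i X i); apply/seteqP; split=> P.
  by move=> [i _]; rewrite fX => /U_CP[A [PA XA]]; apply/U_CP; exists A; split=> //; exists i.
by move=> /U_CP[A [PA [i _ XA]]]; exists i => //; rewrite fX; apply/U_CP; exists A.
Qed.

HB.instance Definition _ := isOpenTopological.Build (Esp subC)
  esp_openT esp_openI esp_open_bigU.

Lemma esp_openP (U : set (Esp subC)) : open U <-> exists X, U = U_C X.
Proof. by []. Qed.

Lemma esp_closedP (Z : set (Esp subC)) : closed Z <-> exists X, Z = Z_C X.
Proof.
rewrite -openC; split.
  by move=> /esp_openP[X ZX]; exists X; apply: setC_inj.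
by move=> [X ->]; apply/esp_openP; exists X.
Qed.

Definition calP (Z : set (Esp subC)) : set E :=
  [set A | U_C [set A] `&` Z !=set0].

End EspTopology.

Section TopologicalNotions.
Context {T : topologicalType}.

Definition noetherian_space : Prop :=
  forall F : nat -> set T, (forall n, closed (F n)) ->
    (forall n, F n.+1 `<=` F n) ->
    exists N, forall n, (N <= n)%N -> F n = F N.

Definition irreducible_subset (Z : set T) : Prop :=
  forall F G : set T, closed F -> closed G -> Z `<=` F `|` G ->
    Z `<=` F \/ Z `<=` G.

Definition sober_space : Prop :=
  forall Z : set T, Z !=set0 -> irreducible_subset Z -> closed Z ->
    exists! x : T, closure [set x] = Z.

End TopologicalNotions.
Arguments noetherian_space T : clear implicits.
Arguments sober_space T : clear implicits.

Definition homeomorphic (T U : topologicalType) : Prop :=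
  exists (f : T -> U) (g : U -> T),
    [/\ continuous f, continuous g, cancel f g & cancel g f].

(* [comPzRingType] allows the zero ring, whose spectrum is empty. *)
Definition prime_ideal (R : comPzRingType) (I : set R) : Prop :=
  [/\ I 0, (forall x y, I x -> I y -> I (x + y)),
      (forall a x, I x -> I (a * x)), ~ I 1 &
      (forall x y, I (x * y) -> I x \/ I y)].

Record Spec (R : comPzRingType) : Type := SpecPoint {
  spec_val :> set R;
  spec_valP : prime_ideal spec_val
}.

Section SpecTopology.
Context {R : comPzRingType}.

HB.instance Definition _ := gen_eqMixin (Spec R).
HB.instance Definition _ := gen_choiceMixin (Spec R).

Definition zariski_closed (S : set R) : set (Spec R) :=
  [set p : Spec R | S `<=` p].

Let spec_open : set_system (Spec R) :=
  [set U | exists S, U = ~` zariski_closed S].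

Let spec_openT : spec_open setT.
Proof.
exists setT; apply/esym/seteqP; split=> // p _ /(_ 1 I).
by have [] := spec_valP p.
Qed.

Let spec_openI : setI_closed spec_open.
Proof.
move=> _ _ [S ->] [T ->]; exists [set z | exists x y, [/\ S x, T y & z = x * y]].
rewrite -setCU; congr (~` _); apply/seteqP; split=> p.
  have [_ _ Mp _ _] := spec_valP p.
  move=> [Sp _ [x [y [Sx _ ->]]]|Tp _ [x [y [_ Ty ->]]]].
    by rewrite mulrC; apply: Mp; apply: Sp.
  by apply: Mp; apply: Tp.
have [_ _ _ _ primep] := spec_valP p.
move=> STp; have [Sp|] := pselect (S `<=` p); first by left.
move=> /existsNP[x /not_implyP[Sx npx]]; right=> y Ty.
by have [] := primep x y; first by apply: STp; exists x, y.
Qed.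

Let spec_open_bigU (I : Type) (f : I -> set (Spec R)) :
  (forall i, spec_open (f i)) -> spec_open (\bigcup_i f i).
Proof.
move=> /choice[S fS]; exists (\bigcup_i S i).
rewrite -[LHS]setCK setC_bigcup; congr (~` _); apply/seteqP; split=> p.
  move=> Sp x [i _ Six]; have := Sp i Logic.I; rewrite fS setCK; exact.
by move=> Sp i _; rewrite fS setCK => x Six; apply: Sp; exists i.
Qed.

HB.instance Definition _ := isOpenTopological.Build (Spec R)
  spec_openT spec_openI spec_open_bigU.

Lemma spec_openP (U : set (Spec R)) :
  open U <-> exists S, U = ~` zariski_closed S.
Proof. by []. Qed.

Lemma spec_closedP (Z : set (Spec R)) :
  closed Z <-> exists S, Z = zariski_closed S.
Proof.
rewrite -openC; split.
  by move=> /spec_openP[S ZS]; exists S; apply: setC_inj.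
by move=> [S ->]; apply/spec_openP; exists S.
Qed.

End SpecTopology.

Definition spectral_space (T : topologicalType) : Prop :=
  exists R : comPzRingType, homeomorphic T (Spec R).

(* Main.v *)
Require Import Defs.
From HB Require Import structures.
From mathcomp Require Import all_boot all_order all_algebra.
From mathcomp Require Import fraction generic_quotient ring zify.
From mathcomp Require Import all_classical topology.

(** The hard implication is Hochster's theorem for a Noetherian sober space [X].
Let [K] be the field of rational functions over [rat] in one variable [T_U] for
each subset [U] of [X]. A point [y] gives the valuation [v_y] of [K] that measures
the order of vanishing in the variables [T_U] with [U] not containing [y]; it is
trivial on the subfield [K_y] generated by the other variables. Consider the ring
of functions [f : X -> K] with [f y] in [K_y], with [v_y (f x - f y) > 0] whenever
[y] lies in the closure of [x], and which are locally constant for the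
constructible topology. Supports of such functions are open, and every open [U] is
the support of [x |-> T_U if x is in U, else 0]. If the support of [a] is contained
in that of [b], then [b] divides a power of [a]: the quotient [a ^ n / b], extended
by [0], still satisfies the congruences, because [v_y (b x)] is bounded by a
degree, uniformly in [x] and [y]. Finally [a + n b] has the union of the supports
of [a] and [b] as its support for some integer [n]. Hence prime ideals correspond
to irreducible closed subsets of [X], that is, to its points. *)

Set Implicit Arguments.
Unset Strict Implicit.
Unset Printing Implicit Defensive.

Import Order.TTheory GRing.Theory Num.Theory.

Local Open Scope classical_set_scope.
Local Open Scope ring_scope.

(** * Noetherian and sober spaces *)

Section Noetherian.
Context {T : topologicalType} (noethT : noetherian_space T).

(** Otherwise dependent choice among the counterexamples yields an infinite strictly descending
    chain of closed sets. *)
Lemma noetherian_induction (P : set T -> Prop) :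
  (forall Z, closed Z ->
     (forall F, closed F -> F `<=` Z -> F <> Z -> P F) -> P Z) ->
  forall Z, closed Z -> P Z.
Proof.
move=> step Z0 clZ0; apply: contrapT => nPZ0.
pose bad := {Z : set T | closed Z /\ ~ P Z}.
have next (Z : bad) : {F : bad | sval F `<=` sval Z & sval F <> sval Z}.
  apply: cid2; case: Z => Z [clZ nPZ] /=; apply: contrapT => nF.
  apply: nPZ; apply: step => // F clF FZ neF; apply: contrapT => nPF.
  by apply: nF; exists (exist _ F (conj clF nPF)).
pose F n := iter n (fun Z => sval (cid2 (let: exist2 F a b := next Z in
  ex_intro2 _ _ F a b))) (exist _ Z0 (conj clZ0 nPZ0) : bad).
have FS n : sval (F n.+1) `<=` sval (F n) /\ sval (F n.+1) <> sval (F n).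
  by rewrite /F iterS; case: cid2.
have [||N FN] := noethT (F := fun n => sval (F n)).
- by move=> n; case: (svalP (F n)).
- by move=> n; case: (FS n).
by have [_] := FS N; apply; rewrite FN.
Qed.

(* In a sober space the irreducible closed sets are the closures of points. *)
Lemma sober_noetherian_induction (P : set T -> Prop) :
  sober_space T -> P set0 ->
  (forall F G, closed F -> closed G -> P F -> P G -> P (F `|` G)) ->
  (forall z, (forall U, open U -> U z -> P (closure [set z] `\` U)) ->
     P (closure [set z])) ->
  forall Z, closed Z -> P Z.
Proof.
move=> soberT P0 PU Pz; apply: noetherian_induction => Z clZ IH.
have [->//|/set0P Z0] := eqVneq Z set0.
have [irrZ|] := pselect (irreducible_subset Z).
  have [z [zZ _]] := soberT Z Z0 irrZ clZ.
  rewrite -zZ; apply: Pz => U oU Uz; apply: IH.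
  - by rewrite setDE; apply: closedI; [exact: closed_closure|exact: open_closedC].
  - by rewrite zZ; exact: subDsetl.
  - rewrite zZ => ZU; have : (Z `\` U) z by rewrite ZU -zZ; exact: subset_closure.
    by case.
move=> /existsNP[F /existsNP[G]].
move=> /not_implyP[clF /not_implyP[clG /not_implyP[ZFG /not_orP[nZF nZG]]]].
(* A reducible [Z] is the union of two proper closed subsets, both within reach of [IH]. *)
have -> : Z = (Z `&` F) `|` (Z `&` G) by rewrite -setIUr; apply/esym/setIidPl.
have clZF : closed (Z `&` F) by exact: closedI.
have clZG : closed (Z `&` G) by exact: closedI.
by apply: PU => //; apply: IH => //; do ?exact: subIsetl => //; move=> /setIidPl.
Qed.

Lemma noetherian_min (F : set (set T)) :
  (forall Z, F Z -> closed Z) -> F !=set0 ->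
  exists Z, F Z /\ forall Y, F Y -> Y `<=` Z -> Y = Z.
Proof.
move=> clF [Z0 FZ0]; apply: contrapT => nmin.
apply: (@noetherian_induction (fun Z => ~ F Z)) (clF _ FZ0) FZ0.
move=> Z clZ IH FZ; apply: nmin.
exists Z; split=> // Y FY YZ; apply: contrapT => neYZ.
exact: IH (clF _ FY) YZ neYZ FY.
Qed.

End Noetherian.

Lemma closure_set1P (T : topologicalType) (x y : T) :
  closure [set x] y <-> forall U : set T, open U -> U y -> U x.
Proof.
split=> [xy U oU Uy|xy B]; last rewrite nbhsE => -[U [oU Uy] UB].
  by have [_ [-> Uw]] := xy U (open_nbhs_nbhs (conj oU Uy)).
by exists x; split => //; exact: UB (xy U oU Uy).
Qed.

Lemma closure_set1_sub (T : topologicalType) (x : T) (Z : set T) :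
  closed Z -> Z x -> closure [set x] `<=` Z.
Proof.
by move=> clZ Zx; rewrite [X in _ `<=` X](closure_id Z).1 //;
  apply: closure_subset => _ ->.
Qed.

Lemma closure_set1_irreducible (T : topologicalType) (x : T) :
  irreducible_subset (closure [set x]).
Proof.
move=> F G clF clG FG.
by case: (FG x (subset_closure erefl)) => ?; [left|right]; exact: closure_set1_sub.
Qed.

Lemma sober_T0 (T : topologicalType) (x y : T) :
  sober_space T -> closure [set x] = closure [set y] -> x = y.
Proof.
move=> soberT xy.
have [||z [_ uz]] := soberT (closure [set x]) _ (@closure_set1_irreducible _ x).
- by exists x; exact: subset_closure.
- exact: closed_closure.
- by rewrite -(uz x) // -(uz y).
Qed.

(** * Rational functions in infinitely many variables *)

(** A nonzero difference would have as many distinct natural numbers as roots as its size, one more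
    than its degree. *)
Lemma poly_horner_inj (F G : {poly rat}) : (forall t, F.[t] = G.[t]) -> F = G.
Proof.
move=> FG; apply/eqP; rewrite -subr_eq0; apply/eqP.
apply: (@roots_geq_poly_eq0 _ _ [seq n%:R | n <- iota 0 (size (F - G))]).
- by apply/allP => t _; rewrite /root hornerE hornerN FG subrr.
- rewrite map_inj_uniq ?iota_uniq // => m n /eqP.
  by rewrite eqr_nat => /eqP.
- by rewrite size_map size_iota.
Qed.

Section PolynomialFunctions.
Context {I : Type}.

(* Polynomials over [rat] with variables indexed by [I], encoded as functions: this
   is faithful because [rat] is infinite. *)
Inductive polynomial_fun : ((I -> rat) -> rat) -> Prop :=
| polynomial_cst c : polynomial_fun (cst c)
| polynomial_coord i : polynomial_fun (fun p => p i)
| polynomial_sub f g :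
    polynomial_fun f -> polynomial_fun g -> polynomial_fun (f - g)
| polynomial_mul f g :
    polynomial_fun f -> polynomial_fun g -> polynomial_fun (f * g).

Definition polynomial_pred : {pred (I -> rat) -> rat} :=
  fun f => `[<polynomial_fun f>].

Lemma polynomial_subring : subring_closed polynomial_pred.
Proof.
split=> [|f g /asboolP pf /asboolP pg|f g /asboolP pf /asboolP pg].
- exact/asboolP/polynomial_cst.
- exact/asboolP/polynomial_sub.
- exact/asboolP/polynomial_mul.
Qed.

Record polyFun : Type := MkPolyFun {
  polyFun_val :> (I -> rat) -> rat;
  _ : polyFun_val \in polynomial_pred
}.
HB.instance Definition _ := [isSub for polyFun_val].
HB.instance Definition _ := [Choice of polyFun by <:].
HB.instance Definition _ :=
  GRing.SubChoice_isSubComPzRing.Build _ _ polyFun polynomial_subring.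

Implicit Types (f g : polyFun) (p q : I -> rat).

Lemma polyFun_ext f g : (forall p, f p = g p) -> f = g.
Proof. by move=> fg; apply/val_inj/funext. Qed.

Definition ev p f : rat := f p.

Lemma ev_zmod_morphism p : zmod_morphism (ev p).
Proof. by []. Qed.

Lemma ev_monoid_morphism p : monoid_morphism (ev p).
Proof. by []. Qed.

HB.instance Definition _ p :=
  GRing.isZmodMorphism.Build polyFun rat (ev p) (ev_zmod_morphism p).
HB.instance Definition _ p :=
  GRing.isMonoidMorphism.Build polyFun rat (ev p) (ev_monoid_morphism p).

Lemma polyFun_oner_neq0 : (1 : polyFun) != 0.
Proof. by apply/eqP => /(congr1 (ev (cst 0))). Qed.

HB.instance Definition _ :=
  GRing.PzSemiRing_isNonZero.Build polyFun polyFun_oner_neq0.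

Definition polyFun_unit : pred polyFun := fun f => `[<exists g, g * f = 1>].

(** Inverses are picked by classical choice; a non-unit is its own default value, as
    [polyFun_inv_out] requires. *)
Definition polyFun_inv f : polyFun :=
  if pselect (exists g, g * f = 1) is left fV then sval (cid fV) else f.

Lemma polyFun_mulVx : {in polyFun_unit, left_inverse 1 polyFun_inv *%R}.
Proof.
move=> f /asboolP fV; rewrite /polyFun_inv; case: pselect => // gV.
by case: (cid gV).
Qed.

Lemma polyFun_unitP f g : g * f = 1 -> f \in polyFun_unit.
Proof. by move=> gf1; apply/asboolP; exists g. Qed.

Lemma polyFun_inv_out : {in [predC polyFun_unit], polyFun_inv =1 id}.
Proof. by move=> f /asboolPn fV; rewrite /polyFun_inv; case: pselect. Qed.

HB.instance Definition _ :=
  GRing.ComNzRing_hasMulInverse.Build polyFun polyFun_mulVx polyFun_unitP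
    polyFun_inv_out.

(** The base cases speak of values only, so that no proof of membership in [polynomial_pred] has to
    be named. *)
Lemma polyFun_ind (P : polyFun -> Prop) :
  (forall c f, (forall p, f p = c) -> P f) ->
  (forall i f, (forall p, f p = p i) -> P f) ->
  (forall f g, P f -> P g -> P (f - g)) ->
  (forall f g, P f -> P g -> P (f * g)) -> forall f, P f.
Proof.
move=> Pc Pi PB PM [f pf].
have/asboolP pf' := pf; elim: pf' pf => [c|i|g h pg IHg ph IHh|g h pg IHg ph IHh] pf.
- exact: (Pc c).
- exact: (Pi i).
- have := PB _ _ (IHg (asboolT pg)) (IHh (asboolT ph)).
  by congr P; apply: val_inj.
- have := PM _ _ (IHg (asboolT pg)) (IHh (asboolT ph)).
  by congr P; apply: val_inj.
Qed.

Lemma polyFun_line p q f :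
  exists F : {poly rat}, forall s, F.[s] = f (fun i => p i + s * (q i - p i)).
Proof.
elim/polyFun_ind: f => [c f fc|i f fi|f g [F fF] [G gG]|f g [F fF] [G gG]].
- by exists c%:P => s; rewrite fc hornerE.
- by exists ((p i)%:P + 'X * (q i - p i)%:P) => s; rewrite fi !hornerE.
- by exists (F - G) => s; rewrite hornerD hornerN fF gG.
- by exists (F * G) => s; rewrite hornerM fF gG.
Qed.

(* Restrict to the line joining two points at which [f], resp. [g], does not
   vanish. *)
Lemma polyFun_integral f g : f * g = 0 -> (f == 0) || (g == 0).
Proof.
apply: contra_eqT => /norP[/eqP f0 /eqP g0]; apply/eqP.
have /existsNP[p /eqP fp] : ~ forall p, f p = 0.
  by move=> ?; apply: f0; exact: polyFun_ext.
have /existsNP[q /eqP gq] : ~ forall p, g p = 0.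
  by move=> ?; apply: g0; exact: polyFun_ext.
move=> fg0; have [[F fF] [G gG]] := (polyFun_line p q f, polyFun_line p q g).
have /eqP : F * G = 0.
  apply: poly_horner_inj => s; rewrite hornerM fF gG horner0.
  exact: (congr1 (ev (fun i => p i + s * (q i - p i))) fg0).
rewrite mulf_eq0 => /orP[] /eqP FG0.
- suff : F.[0] = f p by rewrite FG0 horner0 => /esym/eqP; rewrite (negPf fp).
  by rewrite fF; congr (polyFun_val f); apply/funext => i; rewrite mul0r addr0.
- suff : G.[1] = g q by rewrite FG0 horner0 => /esym/eqP; rewrite (negPf gq).
  by rewrite gG; congr (polyFun_val g); apply/funext => i; rewrite mul1r addrC subrK.
Qed.

HB.instance Definition _ :=
  GRing.ComUnitRing_isIntegral.Build polyFun polyFun_integral.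

Definition rescale (S : set I) (t : rat) p : I -> rat :=
  fun i => if `[< S i >] then t * p i else p i.

(* The coefficients of [F] are those of [f (rescale S t p)] seen as a polynomial in
   [t]; the order of [f] in the variables of [S] is the order of [F] at [0]. *)
Lemma scaling_exists f : exists d, forall S : set I, exists F : {poly polyFun},
  (size F <= d)%N /\ forall p t, (map_poly (ev p) F).[t] = f (rescale S t p).
Proof.
elim/polyFun_ind: f => [c f fc|i f fi|f g [d fF] [e gG]|f g [d fF] [e gG]].
- exists 1%N => S; exists f%:P; rewrite size_polyC leq_b1; split=> // p t.
  by rewrite map_polyC hornerC /= /ev !fc.
(* A coordinate picks up a factor ['X] only when its index is in [S]; the bound 2 covers both
   cases. *)
- exists 2%N => S; exists (if `[< S i >] then 'X * f%:P else f%:P); split.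
    case: ifP => _; last by rewrite size_polyC (leq_trans (leq_b1 _)).
    by rewrite (leq_trans (size_polyMleq _ _)) // size_polyX size_polyC; case: eqP.
  move=> p t; rewrite fi /rescale; case: ifP => _.
    by rewrite rmorphM /= map_polyX map_polyC !hornerE /= /ev fi.
  by rewrite map_polyC !hornerE /= /ev fi.
- exists (maxn d e) => S; have [[F [sF fF']] [G [sG gG']]] := (fF S, gG S).
  exists (F - G); split=> [|p t]; last by rewrite rmorphB !hornerE fF' gG'.
  rewrite (leq_trans (size_polyD _ _)) // size_polyN geq_max !leq_max sF sG.
  by rewrite orbT.
- exists (d + e)%N => S; have [[F [sF fF']] [G [sG gG']]] := (fF S, gG S).
  exists (F * G); split=> [|p t]; last by rewrite rmorphM hornerM fF' gG'.
  by rewrite (leq_trans (size_polyMleq _ _)) // (leq_trans (leq_pred _)) ?leq_add.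
Qed.

End PolynomialFunctions.
Arguments polyFun : clear implicits.

Local Notation "x %:F" := (FracField.tofrac x).

Lemma fraction_rep (R : idomainType) (x : {fraction R}) :
  exists n d : R, d != 0 /\ x = n%:F / d%:F.
Proof.
elim/quotW: x => x; exists (frac x).1, (frac x).2; split.
  exact: denom_ratioP.
rewrite !piE; congr (\pi%qT _).
rewrite /FracField.invf /FracField.mulf !numden_Ratio ?mulf_neq0 ?oner_neq0
  ?denom_ratioP //.
by rewrite mul1r mulr1 Ratio_numden.
Qed.

(* A field with elements [var i] and, for each set [S] of indices, a valuation of
   maximal ideal [vmax S] that is trivial on the subfield [vfix S]; the valuation
   is positive on the variables of [S], and [vfix S] contains the other ones. *)
Record valued_field (I : Type) := ValuedField {
  vfield :> fieldType;
  var : I -> vfield;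
  vmax : set I -> set vfield;
  vfix : set I -> set vfield;
  vnatr_inj : injective (fun n => n%:R : vfield);
  var_neq0 : forall i, var i != 0;
  var_vmax : forall (S : set I) i, S i -> vmax S (var i);
  var_vfix : forall (S : set I) i, ~ S i -> vfix S (var i);
  vfix1 : forall S, vfix S 1;
  vfixB : forall S x y, vfix S x -> vfix S y -> vfix S (x - y);
  vfixM : forall S x y, vfix S x -> vfix S y -> vfix S (x * y);
  vfixV : forall S x, vfix S x -> vfix S x^-1;
  vmax0 : forall S, vmax S 0;
  vmaxB : forall S x y, vmax S x -> vmax S y -> vmax S (x - y);
  vmaxM : forall S x y, vmax S x -> vmax S y -> vmax S (x * y);
  vmax_div : forall S x y, vmax S x -> ~ vmax S y -> vmax S (x / y);
  vfix_vmax0 : forall S x, vfix S x -> vmax S x -> x = 0;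
  vmax_pow : forall y, exists n, forall S x m, (n < m)%N ->
    vmax S x -> vmax S (x ^+ m / y)
}.

Section ValuedFieldTheory.
Context {I : Type} {K : valued_field I}.
Implicit Types (S : set I) (x y : K).

Lemma vfix0 S : vfix S (0 : K).
Proof. by rewrite -(subrr 1); apply: vfixB; exact: vfix1. Qed.

Lemma vfixN S x : vfix S x -> vfix S (- x).
Proof. by rewrite -sub0r; apply: vfixB; exact: vfix0. Qed.

(** A nonzero [x] in [vfix S] is a unit of the valuation ring: [x^-1] is not in [vmax S], so
    [vmax_div] applies to [y / x^-1]. *)
Lemma vmaxMl S x y : vfix S x -> vmax S y -> vmax S (x * y).
Proof.
have [->|x0] := eqVneq x 0; first by rewrite mul0r => _ _; exact: vmax0.
move=> Sx My; rewrite mulrC -(invrK x); apply: vmax_div => // Mx.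
have /eqP := vfix_vmax0 (vfixV Sx) Mx.
by rewrite invr_eq0 (negPf x0).
Qed.

Lemma vmax_pow_seq (s : seq K) : exists n, forall S x y, y \in s ->
  vmax S x -> vmax S (x ^+ n.+1 / y).
Proof.
suff [n nP] : exists n, forall S x y m, (n < m)%N -> y \in s ->
    vmax S x -> vmax S (x ^+ m / y).
  by exists n => S x y; exact: nP.
elim: s => [|y s [n nP]]; first by exists 0%N.
have [m mP] := vmax_pow y; exists (maxn n m) => S x z k.
rewrite gtn_max in_cons => /andP[nk mk] /orP[/eqP ->|zs]; first exact: mP.
exact: nP.
Qed.

End ValuedFieldTheory.

(** * Orders of vanishing along sets of variables *)

Section Valuation.
Context {I : Type}.
Implicit Types (f g : polyFun I) (p q : I -> rat) (S : set I).
Notation K := {fraction (polyFun I)}.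

(** A bound common to all [S]; it need not be the exact total degree. *)
Definition degree f : nat := sval (cid (scaling_exists f)).

Definition scaling S f : {poly polyFun I} :=
  sval (cid (svalP (cid (scaling_exists f)) S)).

Lemma size_scaling S f : (size (scaling S f) <= degree f)%N.
Proof. by have [] := svalP (cid (svalP (cid (scaling_exists f)) S)). Qed.

Lemma scalingE S f p t :
  (map_poly (ev p) (scaling S f)).[t] = f (rescale S t p).
Proof. by have [] := svalP (cid (svalP (cid (scaling_exists f)) S)). Qed.

(** Values in [t] at a fixed [p] determine the specialized polynomial over [rat]; letting [p] vary
    determines each coefficient. *)
Lemma scaling_uniq S f (F : {poly polyFun I}) :
  (forall p t, (map_poly (ev p) F).[t] = f (rescale S t p)) -> scaling S f = F.
Proof.
move=> Ff; apply/polyP => n; apply: polyFun_ext => p.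
suff /(congr1 (fun G : {poly rat} => G`_n)) :
  map_poly (ev p) (scaling S f) = map_poly (ev p) F by rewrite !coef_map.
by apply: poly_horner_inj => t; rewrite scalingE Ff.
Qed.

Lemma scaling_zmod_morphism S : zmod_morphism (scaling S).
Proof.
move=> f g; apply: scaling_uniq => p t.
by rewrite rmorphB !hornerE !scalingE.
Qed.

Lemma scaling_monoid_morphism S : monoid_morphism (scaling S).
Proof.
split=> [|f g]; apply: scaling_uniq => p t; first by rewrite rmorph1 hornerE.
by rewrite rmorphM !hornerE !scalingE.
Qed.

HB.instance Definition _ S :=
  GRing.isZmodMorphism.Build _ _ (scaling S) (scaling_zmod_morphism S).
HB.instance Definition _ S :=
  GRing.isMonoidMorphism.Build _ _ (scaling S) (scaling_monoid_morphism S).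

Lemma scaling_eq0 S f : (scaling S f == 0) = (f == 0).
Proof.
apply/eqP/eqP => [Sf0|->]; last exact: rmorph0.
(* At [t = 1] rescaling is the identity, which recovers [f] from its scaling. *)
apply: polyFun_ext => p; have := scalingE S f p 1; rewrite Sf0 rmorph0 horner0.
rewrite (_ : rescale S 1 p = p) => [<-//|]; apply/funext => i.
by rewrite /rescale mul1r if_same.
Qed.

(** For nonzero [f] this is the lowest degree of [f] in the variables of [S], read off as the
    multiplicity of the root 0 over the fraction field. *)
Definition vorder S f : nat := mup 0 (map_poly (@FracField.tofrac _) (scaling S f)).

Let scalingF_neq0 S f :
  f != 0 -> map_poly (@FracField.tofrac _) (scaling S f) != 0.
Proof.
move=> f0; rewrite map_poly_eq0_id0 ?scaling_eq0 //.
by rewrite tofrac_eq0 lead_coef_eq0 scaling_eq0.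
Qed.

Lemma vorder_le S f : (vorder S f <= degree f)%N.
Proof.
apply: leq_trans (size_scaling S f); rewrite /vorder /mup -ltnS.
apply: leq_trans (ltn_ord _) _; rewrite ltnS; exact: size_poly.
Qed.

Lemma vorderM S f g : f != 0 -> g != 0 ->
  vorder S (f * g) = (vorder S f + vorder S g)%N.
Proof. by move=> f0 g0; rewrite /vorder !rmorphM mupM ?scalingF_neq0. Qed.

Lemma vorderD S f g : f + g != 0 -> f != 0 -> g != 0 ->
  (minn (vorder S f) (vorder S g) <= vorder S (f + g)%R)%N.
Proof.
move=> fg0 f0 g0; rewrite mup_geq ?scalingF_neq0 // !rmorphD dvdp_add //.
  by rewrite -mup_geq ?scalingF_neq0 // geq_minl.
by rewrite -mup_geq ?scalingF_neq0 // geq_minr.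
Qed.

Definition fixed_poly S : set (polyFun I) := [set f | scaling S f = f%:P].

Lemma vorder_fixed S f : fixed_poly S f -> vorder S f = 0%N.
Proof.
rewrite /vorder => ->; rewrite map_polyC /=.
have [->|f0] := eqVneq f 0; last first.
  by rewrite mupNroot // /root hornerC tofrac_eq0.
(* For the zero polynomial the maximum in [mup] is over a single exponent, so the order of 0 is 0
   rather than infinite. *)
by rewrite rmorph0 /= /mup; case: arg_maxnP => // -[]; rewrite size_poly0; case.
Qed.

Lemma vorderN S f : vorder S (- f) = vorder S f.
Proof.
have [->|f0] := eqVneq f 0; first by rewrite oppr0.
rewrite -mulN1r vorderM ?oppr_eq0 ?oner_eq0 // vorder_fixed //.
by rewrite /fixed_poly /= !rmorphN !rmorph1.
Qed.

Lemma coordinate_subproof (i : I) : (fun p => p i) \in @polynomial_pred I.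
Proof. exact/asboolP/polynomial_coord. Qed.

Definition coordinate i : polyFun I := MkPolyFun (coordinate_subproof i).

Lemma coordinate_neq0 i : coordinate i != 0.
Proof. by apply/eqP => /(congr1 (ev (cst 1))) /eqP; rewrite oner_eq0. Qed.

Lemma coordinate_fixed S i : ~ S i -> fixed_poly S (coordinate i).
Proof.
move=> Si; apply: scaling_uniq => p t; rewrite map_polyC hornerC /= /ev /= /rescale.
by rewrite asboolF.
Qed.

Lemma vorder_coordinate S i : S i -> (0 < vorder S (coordinate i))%N.
Proof.
move=> Si; rewrite mup_geq ?scalingF_neq0 ?coordinate_neq0 // expr1 subr0.
rewrite (_ : scaling S _ = 'X * (coordinate i)%:P).
  by rewrite rmorphM /= map_polyX dvdp_mulr.
apply: scaling_uniq => p t.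
by rewrite rmorphM /= map_polyX map_polyC !hornerE /= /ev /= /rescale asboolT.
Qed.

(* [max_ideal S] is the maximal ideal of the valuation ring of the order of
   vanishing in the variables of [S]. *)
Definition max_ideal S : set K := [set x | x = 0 \/
  exists f g, [/\ f != 0, g != 0, x = f%:F / g%:F & (vorder S g < vorder S f)%N]].

(** Independence of the chosen fraction follows by cross-multiplying and using that [vorder] is
    additive. *)
Lemma max_idealP S f g : f != 0 -> g != 0 ->
  max_ideal S (f%:F / g%:F) <-> (vorder S g < vorder S f)%N.
Proof.
move=> f0 g0; split=> [|fg]; last by right; exists f, g.
case=> [/eqP|[f' [g' [f'0 g'0 /eqP + f'g']]]].
  by rewrite mulf_eq0 invr_eq0 !tofrac_eq0 (negPf f0) (negPf g0).
rewrite eqr_div ?tofrac_eq0 // -!rmorphM tofrac_eq => /eqP /(congr1 (vorder S)).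
rewrite !vorderM //; lia.
Qed.

Lemma max_idealB S x y : max_ideal S x -> max_ideal S y -> max_ideal S (x - y).
Proof.
(* Equality is set apart because [vorderD] needs a nonzero numerator. *)
have [->|nexy] := eqVneq x y; first by move=> _ _; rewrite subrr; left.
case=> [->|[f [g [f0 g0 xfg fg]]]].
  rewrite sub0r; case=> [->|[f [g [f0 g0 -> fg]]]]; first by left; rewrite oppr0.
  by right; exists (- f), g; rewrite oppr_eq0 vorderN rmorphN mulNr.
case=> [->|[f' [g' [f'0 g'0 yfg fg']]]].
  by rewrite subr0; right; exists f, g.
have xy : x - y = (f * g' - f' * g)%:F / (g * g')%:F.
  by rewrite xfg yfg -mulNr addf_div ?tofrac_eq0 // mulNr rmorphB !rmorphM.
have fg0 : f * g' - f' * g != 0.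
  apply: contra_neq nexy => fg0; apply/eqP; rewrite -subr_eq0 xy fg0.
  by rewrite rmorph0 mul0r.
right; exists (f * g' - f' * g), (g * g'); split; rewrite ?mulf_neq0 //.
have fN0 : - (f' * g) != 0 by rewrite oppr_eq0 mulf_neq0.
apply: leq_trans (vorderD S fg0 (mulf_neq0 f0 g'0) fN0).
by rewrite vorderN !vorderM //; lia.
Qed.

Lemma max_idealM S x y : max_ideal S x -> max_ideal S y -> max_ideal S (x * y).
Proof.
case=> [->|[f [g [f0 g0 -> fg]]]]; first by rewrite mul0r; left.
case=> [->|[f' [g' [f'0 g'0 -> fg']]]]; first by rewrite mulr0; left.
rewrite mulf_div -!rmorphM; apply/max_idealP; rewrite ?mulf_neq0 // !vorderM //; lia.
Qed.

Lemma max_ideal_div S x y :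
  max_ideal S x -> ~ max_ideal S y -> max_ideal S (x / y).
Proof.
case=> [->|[f [g [f0 g0 -> fg]]]]; first by rewrite mul0r; left.
have [f' [g' [g'0 ->]]] := fraction_rep y.
have [->|f'0] := eqVneq f' 0; first by case; left; rewrite rmorph0 mul0r.
move=> /max_idealP - /(_ f'0 g'0) nfg.
rewrite invf_div mulf_div -!rmorphM; apply/max_idealP; rewrite ?mulf_neq0 //.
by rewrite !vorderM //; lia.
Qed.

(* The powers needed are bounded by the degree of a denominator of [1 / y],
   uniformly in [S]. *)
Lemma max_ideal_pow y : exists n, forall S x m, (n < m)%N ->
  max_ideal S x -> max_ideal S (x ^+ m / y).
Proof.
have [f [g [g0 ->]]] := fraction_rep y.
exists (degree f) => S x m nm.
have m0 : (0 < m)%N by exact: leq_ltn_trans nm.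
have [->|f0] := eqVneq f 0; first by rewrite rmorph0 mul0r invr0 mulr0; left.
case=> [->|[f' [g' [f'0 g'0 -> fg']]]].
  by rewrite expr0n gtn_eqF // mul0r; left.
have vorderX h : h != 0 -> vorder S (h ^+ m) = (m * vorder S h)%N.
  move=> h0; elim: m {nm m0} => [|m IHm].
    by rewrite expr0 vorder_fixed // /fixed_poly /= !rmorph1.
  by rewrite exprS vorderM ?expf_neq0 // IHm mulSn.
rewrite expr_div_n invf_div mulf_div -!rmorphXn -!rmorphM.
apply/max_idealP; rewrite ?mulf_neq0 ?expf_neq0 // !vorderM ?expf_neq0 //.
(* The order of [x] is at least 1, so that of [x ^+ m] is at least [m], which exceeds [degree f] and
   hence the order of [f]. *)
by rewrite !vorderX //; have := vorder_le S f; nia.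
Qed.

Definition fixed_field S : set K := [set x | exists f g,
  [/\ fixed_poly S f, fixed_poly S g, g != 0 & x = f%:F / g%:F]].

Lemma fixed_polyB S f g :
  fixed_poly S f -> fixed_poly S g -> fixed_poly S (f - g).
Proof. by rewrite /fixed_poly /= !rmorphB /= => -> ->. Qed.

Lemma fixed_polyM S f g :
  fixed_poly S f -> fixed_poly S g -> fixed_poly S (f * g).
Proof. by rewrite /fixed_poly /= !rmorphM /= => -> ->. Qed.

Lemma fixed_poly1 S : fixed_poly S 1.
Proof. by rewrite /fixed_poly /= !rmorph1. Qed.

Lemma fixed_poly_field S f : fixed_poly S f -> fixed_field S f%:F.
Proof.
by move=> Sf; exists f, 1; split; rewrite ?oner_neq0 ?rmorph1 ?divr1 //; exact: fixed_poly1.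
Qed.

Lemma fixed_field1 S : fixed_field S 1.
Proof. by rewrite -(rmorph1 (@FracField.tofrac _)); exact/fixed_poly_field/fixed_poly1. Qed.

Lemma fixed_fieldB S x y :
  fixed_field S x -> fixed_field S y -> fixed_field S (x - y).
Proof.
move=> [f [g [Sf Sg g0 ->]]] [f' [g' [Sf' Sg' g'0 ->]]].
exists (f * g' - f' * g), (g * g'); split; last 2 first.
- by rewrite mulf_neq0.
- by rewrite -mulNr addf_div ?tofrac_eq0 // mulNr rmorphB !rmorphM.
- by apply: fixed_polyB; exact: fixed_polyM.
- exact: fixed_polyM.
Qed.

Lemma fixed_fieldM S x y :
  fixed_field S x -> fixed_field S y -> fixed_field S (x * y).
Proof.
move=> [f [g [Sf Sg g0 ->]]] [f' [g' [Sf' Sg' g'0 ->]]].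
exists (f * f'), (g * g'); split; rewrite ?mulf_neq0 ?mulf_div ?rmorphM //.
- exact: fixed_polyM.
- exact: fixed_polyM.
Qed.

Lemma fixed_fieldV S x : fixed_field S x -> fixed_field S x^-1.
Proof.
move=> [f [g [Sf Sg g0 ->]]]; have [->|f0] := eqVneq f 0.
  rewrite rmorph0 mul0r invr0 -(subrr 1).
  by apply: fixed_fieldB; exact: fixed_field1.
by exists g, f; rewrite invf_div.
Qed.

Lemma fixed_max_ideal0 S x : fixed_field S x -> max_ideal S x -> x = 0.
Proof.
move=> [f [g [Sf Sg g0 ->]]]; have [->|f0] := eqVneq f 0.
  by rewrite rmorph0 mul0r.
by move/max_idealP => - /(_ f0 g0); rewrite !vorder_fixed.
Qed.

Lemma natr_inj_fraction : injective (fun n => n%:R : K).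
Proof.
move=> m n /eqP; rewrite -!(rmorph_nat (@FracField.tofrac _)) tofrac_eq => /eqP.
by move=> /(congr1 (ev (cst 0))); rewrite !rmorph_nat => /eqP; rewrite eqr_nat => /eqP.
Qed.

Lemma tofrac_coordinate_neq0 i : (coordinate i)%:F != 0 :> K.
Proof. by rewrite tofrac_eq0 coordinate_neq0. Qed.

Lemma max_ideal_coordinate S i : S i -> max_ideal S (coordinate i)%:F.
Proof.
move=> Si; right; exists (coordinate i), 1.
rewrite coordinate_neq0 oner_neq0 rmorph1 divr1; split=> //.
by rewrite vorder_fixed ?vorder_coordinate //; exact: fixed_poly1.
Qed.

Lemma fixed_field_coordinate S i : ~ S i -> fixed_field S (coordinate i)%:F.
Proof. by move=> Si; exact/fixed_poly_field/coordinate_fixed. Qed.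

Lemma max_ideal0 S : max_ideal S 0.
Proof. by left. Qed.

End Valuation.

Definition rational_functions (I : Type) : valued_field I :=
  ValuedField (@natr_inj_fraction I) (@tofrac_coordinate_neq0 I)
    (@max_ideal_coordinate I) (@fixed_field_coordinate I)
    (@fixed_field1 I) (@fixed_fieldB I) (@fixed_fieldM I) (@fixed_fieldV I)
    (@max_ideal0 I) (@max_idealB I) (@max_idealM I) (@max_ideal_div I)
    (@fixed_max_ideal0 I) (@max_ideal_pow I).

(** * The ring attached to a Noetherian sober space *)

(** The right-hand side is built from [a - b] and [c - d] with coefficients [b] and [d] only, the
    values at the specialization, which lie in [vfix]. *)
Lemma mulrBB (R : comPzRingType) (a b c d : R) :
  a * c - b * d = (a - b) * (c - d) - (- b * (c - d) - d * (a - b)).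
Proof. ring. Qed.

Lemma mulrCB (R : comPzRingType) (a b c d : R) :
  a * d + - b * c = d * (a - b) - b * (c - d).
Proof. ring. Qed.

Section Spring.
Context {X : topologicalType} {K : valued_field (set X)}.
Implicit Types (x y z : X) (U : set X).

Definition avoiding y : set (set X) := [set U | ~ U y].

(** In a Noetherian sober space, open neighbourhoods of [z] cut with the closure of [z] form a
    neighbourhood basis of [z] for the constructible topology. *)
Definition locally_constructible (f : X -> K) := forall z, exists U,
  [/\ open U, U z & forall x, U x -> closure [set z] x -> f x = f z].

Definition spring_fun (f : X -> K) : Prop :=
  [/\ forall y, vfix (avoiding y) (f y),
      forall x y, closure [set x] y -> vmax (avoiding y) (f x - f y) &
      locally_constructible f].

Definition spring_pred : {pred X -> K} := fun f => `[<spring_fun f>].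

Lemma locally_constructible2 (op : K -> K -> K) (f g : X -> K) :
  locally_constructible f -> locally_constructible g ->
  locally_constructible (fun x => op (f x) (g x)).
Proof.
move=> cf cg z; have [[U [oU Uz Uf]] [V [oV Vz Vg]]] := (cf z, cg z).
exists (U `&` V); split=> [||x [Ux Vx] zx]; [exact: openI|by []|].
by rewrite Uf // Vg.
Qed.

Lemma spring_subring : subring_closed spring_pred.
Proof.
split=> [|f g /asboolP[kf mf cf] /asboolP[kg mg cg]|
          f g /asboolP[kf mf cf] /asboolP[kg mg cg]]; apply/asboolP; split.
- by move=> y; exact: vfix1.
- by move=> x y _; rewrite subrr; exact: vmax0.
- by move=> z; exists setT; split=> //; exact: openT.
- by move=> y; exact: vfixB.
- move=> x y xy; have -> : (f - g) x - (f - g) y = (f x - f y) - (g x - g y).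
    by rewrite !fctE opprD addrACA -opprD.
  by apply: vmaxB; [exact: mf|exact: mg].
- exact: (@locally_constructible2 (fun a b => a - b)).
- by move=> y; exact: vfixM.
- move=> x y xy; have -> : (f * g) x - (f * g) y = (f x - f y) * (g x - g y)
      - (- f y * (g x - g y) - g y * (f x - f y)).
    exact: mulrBB.
  have [mfxy mgxy] := (mf x y xy, mg x y xy).
  have kNf : vfix (avoiding y) (- f y) by exact: vfixN.
  apply: vmaxB; first exact: vmaxM.
  by apply: vmaxB; exact: vmaxMl.
- exact: (@locally_constructible2 (fun a b => a * b)).
Qed.

Record spring : Type := MkSpring {
  spring_val :> X -> K;
  _ : spring_val \in spring_pred
}.
HB.instance Definition _ := [isSub for spring_val].
HB.instance Definition _ := [Choice of spring by <:].
HB.instance Definition _ :=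
  GRing.SubChoice_isSubComPzRing.Build _ _ spring spring_subring.

Implicit Types a b c : spring.

Lemma springP a : spring_fun a.
Proof. exact/asboolP/(valP a). Qed.

Lemma spring_ext a b : (forall x, a x = b x) -> a = b.
Proof. by move=> ab; apply/val_inj/funext. Qed.

Lemma springDE a b x : (a + b) x = a x + b x. Proof. by []. Qed.
Lemma springME a b x : (a * b) x = a x * b x. Proof. by []. Qed.

Lemma springXE a n x : (a ^+ n) x = a x ^+ n.
Proof. by elim: n => // n IHn; rewrite !exprS springME IHn. Qed.

Lemma spring_natE n x : (n%:R : spring) x = n%:R.
Proof. by elim: n => // n IHn; rewrite !mulrS springDE IHn. Qed.

Definition support a : set X := [set x | a x != 0].

Section Indeterminate.
Context {U : set X} (oU : open U).

Definition indeterminate_fun x : K :=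
  if `[< U x >] then var K U else 0.

Lemma indeterminate_subproof : indeterminate_fun \in spring_pred.
Proof.
apply/asboolP; rewrite /indeterminate_fun; split.
- move=> y; case: asboolP => Uy.
    by apply: var_vfix; rewrite /avoiding /=.
  exact: vfix0.
(* If [U] contains [y] it contains [x] and the difference is 0; otherwise [U] is among the variables
   of positive value at [y]. *)
- move=> x y /closure_set1P/(_ U oU) xy.
  case: (asboolP (U y)) => Uy; first by
    rewrite asboolT ?subrr; [exact: vmax0|exact: xy].
  by rewrite subr0; case: asboolP => _; [exact: var_vmax|exact: vmax0].
- move=> z; have [Uz|nUz] := pselect (U z).
    by exists U; split => // x Ux _; rewrite !asboolT.
  exists setT; split=> // [|x _ /closure_set1P zx]; first exact: openT.
  by rewrite !asboolF // => /(zx _ oU).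
Qed.

Definition indeterminate : spring := MkSpring indeterminate_subproof.

Lemma support_indeterminate : support indeterminate = U.
Proof.
apply/seteqP; split=> x; rewrite /support /= /indeterminate_fun.
  by case: asboolP => //; rewrite eqxx.
by move=> Ux; rewrite asboolT // var_neq0.
Qed.

End Indeterminate.

(* A value that is nonzero at [y] is a unit at [y], hence stays nonzero at the
   generizations of [y]. *)
Lemma support_generization a x y :
  closure [set x] y -> support a y -> ~ vmax (avoiding y) (a x).
Proof.
have [ka ma _] := springP a => xy /negP ay axM; apply: ay; apply/eqP.
apply: vfix_vmax0 (ka y) _.
by rewrite -[a y](subKr (a x)); apply: vmaxB => //; exact: ma.
Qed.

(** * Supports, divisibility and prime ideals *)

Hypotheses (noethX : noetherian_space X) (soberX : sober_space X).

(** On the closure of [z], [a] is constant near [z], and the rest is a smaller closed set. *)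
Lemma spring_finite_range a : exists s : seq K, forall x, a x \in s.
Proof.
suff : exists s : seq K, forall x, [set: X] x -> a x \in s.
  by case=> s sP; exists s => x; exact: sP.
apply: (sober_noetherian_induction noethX
  (P := fun Z => exists s : seq K, forall x, Z x -> a x \in s)) => //.
- by exists [::].
- move=> F G _ _ [s sF] [t tG]; exists (s ++ t) => x.
  by rewrite mem_cat => -[/sF|/tG] ->; rewrite ?orbT.
- move=> z IH; have [_ _ /(_ z) [U [oU Uz aU]]] := springP a.
  have [s sP] := IH U oU Uz; exists (a z :: s) => x zx.
  rewrite in_cons; have [Ux|nUx] := pselect (U x); first by rewrite aU ?eqxx.
  by rewrite sP ?orbT.
Qed.

(** Noetherian induction shows that the zeros of [a] in each closed set form a closed set. *)
Lemma support_open a : open (support a).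
Proof.
rewrite -closedC -(setTI (~` support a)).
apply: (sober_noetherian_induction noethX
  (P := fun Z => closed (Z `&` ~` support a))) => //.
- by rewrite set0I; exact: closed0.
- by move=> F G _ _ ? ?; rewrite setIUl; exact: closedU.
- move=> z IH; have [_ _ /(_ z) [U [oU Uz aU]]] := springP a.
  have [az|az] := pselect (support a z).
    rewrite (_ : _ `&` _ = (closure [set z] `\` U) `&` ~` support a).
      exact: IH.
    apply/seteqP; split=> x [zx ax]; split=> //; last by case: zx.
    by split=> // Ux; apply: ax; rewrite /support /= aU.
  (* When [a z = 0], [a] vanishes on the whole closure of [z] by [support_generization]. *)
  rewrite setIidl; first exact: closed_closure.
  move=> x zx ax; apply: (support_generization zx ax).
  by move/negP/negPn/eqP: az => ->; exact: vmax0.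
Qed.

Lemma spring_div a b : support a `<=` support b ->
  exists n c, a ^+ n.+1 = b * c.
Proof.
move=> ab; have [s bs] := spring_finite_range b.
have [n nP] := vmax_pow_seq s.
have b0 x : b x = 0 -> a x = 0.
  by move=> bx; apply/eqP/negPn/negP => /ab; rewrite /support /= bx eqxx.
(* Since division by 0 gives 0, this quotient is 0 outside the support of [b]. *)
have cP : (fun x => a x ^+ n.+1 / b x) \in spring_pred.
  apply/asboolP; have [kb mb cb] := springP b.
  have [kan man can] := springP (a ^+ n.+1); split.
  - by move=> y; rewrite -springXE; apply: vfixM => //; exact: vfixV.
  - move=> x y xy; have [by0|by0] := eqVneq (b y) 0.
      rewrite (b0 y by0) expr0n mul0r subr0; apply: nP => //.
      by have [_ /(_ x y xy) + _] := springP a; rewrite (b0 y by0) subr0.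
    have nbx := support_generization xy by0.
    have bx0 : b x != 0 by apply: contra_notN nbx => /eqP ->; exact: vmax0.
    rewrite -!springXE -mulNr addf_div //.
    (* Neither denominator does harm: [b x] is not in [vmax (avoiding y)] and the inverse of [b y]
       is in [vfix (avoiding y)]. *)
    rewrite [b x * _]mulrC invfM mulrA; apply: vmax_div => //.
    rewrite mulrC; apply: vmaxMl; first exact: vfixV.
    rewrite mulrCB.
    apply: vmaxB; apply: vmaxMl => //; [exact: man|exact: mb].
  - have := @locally_constructible2 (fun u v => u / v) _ _ can cb.
    by congr locally_constructible; apply/funext => x; rewrite springXE.
exists n, (MkSpring cP); apply: spring_ext => x.
rewrite springME springXE /=; have [bx|bx] := eqVneq (b x) 0.
  by rewrite bx mul0r (b0 x bx) expr0n.
by rewrite mulrC divfK.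
Qed.

(** Cancellation where [b] is nonzero forces [n] to be one of the finitely many ratios
    [- a x / b x]; some natural number avoids them all. *)
Lemma support_union a b : exists n,
  support (a + n%:R * b) = support a `|` support b.
Proof.
have [[s sa] [t tb]] := (spring_finite_range a, spring_finite_range b).
pose r : seq K := [seq - u / v | u <- s, v <- t].
have [n nr] : exists n, n%:R \notin r.
  apply: contrapT => /forallNP nr.
  have : (size [seq n%:R : K | n <- iota 0 (size r).+1] <= size r)%N.
    apply: uniq_leq_size => [|_ /mapP[n _ ->]]; last exact/negPn/negP/nr.
    by rewrite map_inj_uniq ?iota_uniq //; exact: vnatr_inj.
  by rewrite size_map size_iota ltnn.
exists n; apply/seteqP; split=> x;
  rewrite /support /mkset springDE springME spring_natE.
  have [ax|] := eqVneq (a x) 0; last by left.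
  by rewrite ax add0r mulf_eq0 negb_or => /andP[]; right.
have [bx|bx _] := eqVneq (b x) 0.
  by rewrite bx mulr0 addr0 => -[//|]; rewrite bx eqxx.
apply: contra nr; rewrite addrC addr_eq0 => /eqP nab.
by apply/allpairsP; exists (a x, b x); split; rewrite //= -nab mulfK.
Qed.

(* The supports of the elements of a prime ideal have a largest element, whose
   complement is irreducible; [x] is its generic point. *)
Lemma prime_ideal_point (I : set spring) :
  prime_ideal I -> exists x, I = [set a | a x = 0].
Proof.
move=> [I0 ID IM I1 Iprime].
have [||Z [[a [Ia Za]] Zmin]] := noetherian_min noethX
    (F := [set Z | exists a, I a /\ Z = ~` support a]).
- by move=> _ [a [_ ->]]; apply: open_closedC; exact: support_open.
- by exists (~` support 0), 0.
(* Minimality of [Z] against a union of supports gives one direction; conversely a power of [b] is a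
   multiple of [a], and [I] is prime. *)
have IZ b : I b <-> Z `<=` ~` support b.
  split=> [Ib|]; last rewrite Za => ba.
    have [n nab] := support_union a b.
    rewrite -(Zmin (~` (support (a + n%:R * b)))).
    - by rewrite nab setCU; exact: subIsetr.
    - by exists (a + n%:R * b); split=> //; apply: ID => //; exact: IM.
    - by rewrite Za nab setCU; exact: subIsetl.
  have [n [c abc]] : exists n c, b ^+ n.+1 = a * c.
    by apply: spring_div; rewrite -[support a]setCK -[support b]setCK; exact: subsetC.
  have : I (b ^+ n.+1) by rewrite abc mulrC; exact: IM.
  elim: n {abc} => [//|n IHn]; rewrite exprS => /Iprime[//|]; exact: IHn.
have Z0 : Z !=set0.
  apply/set0P/eqP => Z0; apply/I1/IZ; rewrite Z0; exact: sub0set.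
have irrZ : irreducible_subset Z.
  move=> F G clF clG ZFG.
  have oF : open (~` F) by rewrite openC.
  have oG : open (~` G) by rewrite openC.
  (* On [Z] one factor always vanishes, so primality places [Z] inside [F] or [G]. *)
  have : I (indeterminate oF * indeterminate oG).
    apply/IZ => z /ZFG FGz.
    rewrite /support /setC /mkset springME mulf_eq0 negb_or => /andP[uz vz].
    have : support (indeterminate oF) z by [].
    have : support (indeterminate oG) z by [].
    by rewrite !support_indeterminate; case: FGz.
  by move=> /Iprime[]/IZ; rewrite support_indeterminate setCK => ?; [left|right].
have [|x [xZ _]] := soberX Z0 irrZ.
  by rewrite Za; apply: open_closedC; exact: support_open.
exists x; apply/seteqP; split=> b /=.
  move=> /IZ/(_ x); rewrite -xZ => /(_ (subset_closure erefl)).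
  by move/negP/negPn/eqP.
move=> bx; apply/IZ; rewrite -xZ; apply: closure_set1_sub.
  by apply: open_closedC; exact: support_open.
by rewrite /support /= bx eqxx.
Qed.

Lemma point_ideal_prime x : prime_ideal [set a : spring | a x = 0].
Proof.
split=> [//|a b ax bx|a b bx|/eqP|a b].
- by rewrite /mkset springDE ax bx addr0.
- by rewrite /mkset springME bx mulr0.
- by rewrite (_ : (1 : spring) x = 1) // oner_eq0.
- by rewrite /mkset springME => /eqP; rewrite mulf_eq0 => /orP[]/eqP; [left|right].
Qed.

Definition point_ideal x : Spec spring := SpecPoint (point_ideal_prime x).

Lemma Spec_ext (R : comPzRingType) (p q : Spec R) :
  spec_val p = spec_val q -> p = q.
Proof.
by case: p q => [p pP] [q qP] /= pq; subst q; congr SpecPoint; exact: Prop_irrelevance.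
Qed.

(** The homeomorphism is [point_ideal]: sobriety makes it bijective, and supports, being exactly the
    open sets, match the two topologies. *)
Lemma sober_spectral : spectral_space X.
Proof.
have /choice[g gP] : forall p : Spec spring, exists x, spec_val p = [set a | a x = 0].
  by move=> p; exact/prime_ideal_point/spec_valP.
have gK : cancel g point_ideal by move=> p; apply: Spec_ext; rewrite (gP p).
have indP U (oU : open U) x : U x <-> indeterminate oU x <> 0.
  by rewrite -[in X in X <-> _](support_indeterminate oU); split=> [/eqP//|/eqP].
have inj : injective point_ideal.
  move=> x y /(congr1 (@spec_val _)) xy; apply: sober_T0 => //.
  have ind U (oU : open U) : U x <-> U y.
    rewrite !(indP U oU); apply: not_iff_compat.
    by rewrite -[_ = 0]/(spec_val (point_ideal x) _) xy.
  by apply/seteqP; split=> z /closure_set1P zU;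
    apply/closure_set1P => U oU /(zU U oU)/(ind U oU).
exists spring, point_ideal, g; split => //; last by move=> x; apply: inj; rewrite gK.
- apply/continuousP => _ /spec_openP[S ->].
  rewrite (_ : _ @^-1` _ = \bigcup_(a in S) support a).
    by apply: bigcup_open => a _; exact: support_open.
  apply/seteqP; split=> x.
    by move=> /existsNP[a /not_implyP[Sa /eqP ax]]; exists a.
  by move=> [a Sa /eqP ax] /(_ a Sa).
- apply/continuousP => U oU; apply/spec_openP; exists [set indeterminate oU].
  apply/seteqP; split=> p.
    by move=> /(indP U oU) Up /(_ _ erefl); rewrite gP.
  by move=> Up; apply/(indP U oU) => Up0; apply: Up => _ ->; rewrite gP.
Qed.

End Spring.

(** * Spectra are sober *)

Lemma closure_homeo (T U : topologicalType) (f : T -> U) (g : U -> T) (t : T) :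
  continuous f -> continuous g -> cancel f g -> cancel g f ->
  closure [set f t] = g @^-1` closure [set t].
Proof.
move=> /continuousP cf /continuousP cg fK gK.
apply/seteqP; split=> y /closure_set1P cl; apply/closure_set1P => V oV Vy.
  by rewrite -(fK t); exact: cl (cg _ oV) Vy.
by apply: cl (cf _ oV) _; rewrite /= gK.
Qed.

Lemma sober_homeo (T U : topologicalType) :
  homeomorphic T U -> sober_space U -> sober_space T.
Proof.
move=> [f [g [cf cg fK gK]]] soberU Z [z Zz] irrZ clZ.
have gI (A B : set T) : g @^-1` A = g @^-1` B -> A = B.
  by move=> /seteqP[AB BA]; apply/seteqP; split=> t;
    rewrite -(fK t); [exact: AB|exact: BA].
have [||| w [wZ uw]] := soberU (g @^-1` Z).
- by exists (f z); rewrite /= fK.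
- move=> F G clF clG ZFG.
  have clf (H : set U) : closed H -> closed (f @^-1` H).
    exact: (continuous_closedP f).1 cf H.
  case: (irrZ _ _ (clf F clF) (clf G clG)) => [t Zt|ZF|ZG].
  - by apply: ZFG; rewrite /= fK.
  - by left=> y /ZF; rewrite /= gK.
  - by right=> y /ZG; rewrite /= gK.
- exact: (continuous_closedP g).1 cg Z clZ.
exists (g w); split=> [|t tZ].
  by apply: gI; rewrite -(closure_homeo _ cf cg fK gK) gK.
by rewrite (uw (f t)) ?fK // (closure_homeo _ cf cg fK gK) tZ.
Qed.

Lemma closure_SpecP (R : comPzRingType) (p q : Spec R) :
  closure [set p] q <-> (p : set R) `<=` q.
Proof.
split=> [/closure_set1P pq a pa|pq].
  apply: contrapT => nqa.
  have /(_ _ _) := pq (~` zariski_closed [set a]); apply.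
  - by apply/spec_openP; exists [set a].
  - by move=> /(_ a erefl).
  - by move=> _ ->.
apply/closure_set1P => U /spec_openP[S ->] nSq Sp; apply: nSq.
by move=> a /Sp/pq.
Qed.

(** The generic point is the intersection of all primes in [Z], which is prime because [Z] is
    irreducible. *)
Lemma sober_Spec (R : comPzRingType) : sober_space (Spec R).
Proof.
move=> Z [p0 Zp0] irrZ clZ.
pose I := [set a : R | forall p, Z p -> (p : set R) a].
have Iprime : prime_ideal I.
  split.
  - by move=> p _; have [] := spec_valP p.
  - move=> x y Ix Iy p Zp; have [_ D _ _ _] := spec_valP p.
    by apply: D; [exact: Ix|exact: Iy].
  - move=> a x Ix p Zp; have [_ _ M _ _] := spec_valP p; exact/M/Ix.
  - by move=> /(_ p0 Zp0); have [] := spec_valP p0.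
  - move=> x y Ixy.
    have [|||ZV|ZV] := irrZ (zariski_closed [set x]) (zariski_closed [set y]).
    + by apply/spec_closedP; exists [set x].
    + by apply/spec_closedP; exists [set y].
    + move=> p Zp; have [_ _ _ _ pr] := spec_valP p.
      by case: (pr x y (Ixy p Zp)) => ?; [left|right] => _ ->.
    + by left=> p /ZV; apply.
    + by right=> p /ZV; apply.
exists (SpecPoint Iprime); split=> [|q qZ].
  apply/seteqP; split=> q; last by move=> Zq; apply/closure_SpecP => a; apply.
  move/spec_closedP: (clZ) => [S ZS]; move=> /closure_SpecP Iq.
  by rewrite ZS => a Sa; apply: Iq => p; rewrite ZS; apply.
apply: Spec_ext; apply/seteqP; split=> a /=.
  by apply; rewrite -qZ; exact: subset_closure.
by move=> qa p; rewrite -qZ => /closure_SpecP; apply.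
Qed.

(** * The space Esp_C(E) *)

Section Esp.
Context {E : extriangulated_category} {C : set (set E)}
  {subC : C `<=` as_subcat E}.
Implicit Types (P Q : Esp subC) (Z : set (Esp subC)).

Lemma Esp_ext P Q : (P : set E) = Q -> P = Q.
Proof.
by case: P Q => [P CP] [Q CQ] /= PQ; subst Q; congr EspPoint; exact: Prop_irrelevance.
Qed.

(** The order is opposite to that of [closure_SpecP]: specializing shrinks the subcategory. *)
Lemma closure_EspP P Q : closure [set P] Q <-> (Q : set E) `<=` P.
Proof.
split=> [/closure_set1P PQ A QA|QP].
  have : U_C [set A] P.
    by apply: PQ; [apply/esp_openP; exists [set A]|apply/U_CP; exists A].
  by move=> /U_CP[B [PB /= BA]]; rewrite -BA.
apply/closure_set1P => U /esp_openP[X ->] /U_CP[A [QA XA]].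
by apply/U_CP; exists A; split=> //; exact: QP.
Qed.

Lemma calPE Z : calP Z = [set A | exists2 P, Z P & (P : set E) A].
Proof.
apply/seteqP; split=> A.
  by move=> [P [/U_CP[B [PB /= BA]] ZP]]; exists P => //; rewrite -BA.
by move=> [P ZP PA]; exists P; split=> //; apply/U_CP; exists A.
Qed.

Lemma calP_closure P : calP (closure [set P]) = P.
Proof.
rewrite calPE; apply/seteqP; split=> A; first by move=> [Q /closure_EspP QP /QP].
by move=> PA; exists P => //; exact: subset_closure.
Qed.

(** [calP Z] is the union of the members of [Z]. If all of them miss [X], so does the union, which
    thus lies in [Z] and contains every member. *)
Lemma closure_calP Z (CZ : C (calP Z)) :
  closed Z -> closure [set EspPoint subC CZ] = Z.
Proof.
move=> clZ; have [X ZX] := (esp_closedP Z).1 clZ.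
have Zg : Z (EspPoint subC CZ).
  rewrite [in X in X _]ZX; apply/seteqP; split=> // A [/= + XA]; rewrite calPE => -[P].
  by rewrite ZX => PX PA; have : ((P : set E) `&` X) A by []; rewrite PX.
apply/seteqP; split; first exact: closure_set1_sub.
by move=> Q ZQ; apply/closure_EspP => A QA /=; rewrite calPE; exists Q.
Qed.

(** By [calP_closure] the only possible generic point of [Z] is [calP Z], so existence amounts to
    its membership in [C]. *)
Lemma sober_EspP : sober_space (Esp subC) <->
  forall Z, Z !=set0 -> irreducible_subset Z -> closed Z -> C (calP Z).
Proof.
split=> [soberE Z Z0 irrZ clZ|CZ Z Z0 irrZ clZ].
  by have [P [<- _]] := soberE Z Z0 irrZ clZ; rewrite calP_closure; exact: esp_valP.
exists (EspPoint subC (CZ Z Z0 irrZ clZ)); split; first exact: closure_calP.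
by move=> Q QZ; apply: Esp_ext; rewrite /= -QZ calP_closure.
Qed.

End Esp.

Theorem theorem4p3 (E : extriangulated_category) (C : set (set E))
    (subC : C `<=` as_subcat E) (noethC : noetherian_space (Esp subC)) :
  (spectral_space (Esp subC) <-> sober_space (Esp subC)) /\
  (spectral_space (Esp subC) <->
     forall Z : set (Esp subC),
       Z !=set0 -> irreducible_subset Z -> closed Z -> C (calP Z)).
Proof.
have spectralP : spectral_space (Esp subC) <-> sober_space (Esp subC).
  split=> [[R homeoR]|soberE]; first exact: sober_homeo homeoR (@sober_Spec R).
  (* The variables are indexed by all subsets of [Esp subC]. *)
  exact: (sober_spectral (K := rational_functions _)).
by split=> //; rewrite spectralP; exact: sober_EspP.
Qed.
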